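(* Let $M$ be a multiplication module over a commutative Noetherian ring $R$, and suppose that $N$ is a proper submodule of $M$ such that the ideal $N:_RM$ of $R$ is not prime. Then $N$ is strongly irreducible if and only if there exist a submodule $L$ of $M$ and a prime ideal $\mathfrak p$ of $R$ such that $N$ is $\mathfrak p$-primary, $N\subsetneqq L\subseteq\mathfrak pM$, and for all submodules $K$ of $M$ either $K\subseteq N$ or $L_{\mathfrak p}\subseteq K_{\mathfrak p}$.
   Context: All rings are commutative with non-zero identity. An $R$-module $M$ is a multiplication module if every submodule of $M$ is of the form $\mathfrak bM$ for some ideal $\mathfrak b$ of $R$. A submodule $N$ of $M$ is strongly irreducible if for all submodules $K,L$ of $M$, $K\cap L\subseteq N$ implies $K\subseteq N$ or $L\subseteq N$. $N:_RM=\{r\in R: rM\subseteq N\}$. A proper submodule $N$ is primary if $rx\in N$ with $r\in R$, $x\in M\setminus N$ implies $r\in\operatorname{Rad}(N:_RM)$ (radical of the ideal); it is $\mathfrak p$-primary if moreover $\mathfrak p=\operatorname{Rad}(N:_RM)$. Localizations $L_{\mathfrak p},K_{\mathfrak p}$ are regarded as submodules of $M_{\mathfrak p}$. *)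

(* Defs.v *)
From HB Require Import structures.
From mathcomp Require Import all_boot all_order all_algebra ring_quotient.
From mathcomp Require Import ring.
From mathcomp Require Import boolp classical_sets.

Set Implicit Arguments.
Unset Strict Implicit.
Unset Printing Implicit Defensive.

Import GRing.Theory.
Local Open Scope quotient_scope.
Local Open Scope ring_scope.
Local Open Scope classical_set_scope.

(* Subsets are Prop-valued ([set M]); [mem] turns them into the boolean
   collective predicates on which the MathComp closure conditions are stated. *)
Definition submodule (R : comNzRingType) (M : lmodType R) (N : set M) : Prop :=
  GRing.submod_closed (mem N).

(* Ideals may be improper, in contrast to MathComp's [idealr_closed]. *)
Definition ideal (R : comNzRingType) (I : set R) : Prop :=
  submodule (I : set R^o).

Definition prime_ideal (R : comNzRingType) (p : set R) : Prop :=
  idealr_closed (mem p) /\ prime_idealr_closed (mem p).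

Definition noetherian (R : comNzRingType) : Prop :=
  forall I : set R, ideal I ->
    exists (n : nat) (g : 'I_n -> R),
      I = [set r | exists c : 'I_n -> R, r = \sum_(i < n) c i * g i].

Section Modules.
Variables (R : comNzRingType) (M : lmodType R).

Definition ideal_mul (b : set R) : set M :=
  [set x | exists (n : nat) (a : 'I_n -> R) (y : 'I_n -> M),
     (forall i, b (a i)) /\ x = \sum_(i < n) a i *: y i].

Definition multiplication_module : Prop :=
  forall N : set M, submodule N -> exists2 b : set R, ideal b & N = ideal_mul b.

Definition strongly_irreducible (N : set M) : Prop :=
  submodule N /\
  forall K L : set M, submodule K -> submodule L ->
    K `&` L `<=` N -> K `<=` N \/ L `<=` N.

Definition proper_submodule (N : set M) : Prop := submodule N /\ N <> setT.

Definition colon (N : set M) : set R := [set r | forall x : M, N (r *: x)].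

Definition radical (I : set R) : set R :=
  [set r | exists2 n : nat, (0 < n)%N & I (r ^+ n)].

Definition primary (N : set M) : Prop :=
  proper_submodule N /\
  forall (r : R) (x : M), N (r *: x) -> ~ N x -> radical (colon N) r.

Definition primary_to (p : set R) (N : set M) : Prop :=
  primary N /\ p = radical (colon N).

End Modules.

Arguments ideal_mul {R} M b.
Arguments multiplication_module {R} M.

Lemma submoduleP (R : comNzRingType) (M : lmodType R) (N : set M) :
  submodule N <->
  N 0 /\ forall (a : R) (x y : M), N x -> N y -> N (a *: x + y).
Proof.
split=> -[N0 NS]; split.
- exact: set_mem N0.
- by move=> a x y Nx Ny; apply: set_mem; apply: NS; exact: mem_set.
- exact: mem_set.
- by move=> a x y /set_mem Nx /set_mem Ny; apply: mem_set; exact: NS.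
Qed.

Lemma prime_idealP (R : comNzRingType) (p : set R) :
  prime_ideal p <->
  [/\ ideal p, ~ p 1 & forall a b : R, p (a * b) -> p a \/ p b].
Proof.
split=> [[[p0 p1 pS] pM]|[/submoduleP[p0 pS] p1 pM]].
  split=> [||a b /mem_set/pM/orP[] /set_mem]; [by split | | by left | by right].
  by move/mem_set; apply/negP.
split; first split.
- exact: mem_set.
- by apply/negP => /set_mem.
- by move=> a x y /set_mem px /set_mem py; apply: mem_set; exact: pS.
- by move=> a b /set_mem/pM[] /mem_set h; apply/orP; [left | right].
Qed.

(* The localization of [M] at [p]: pairs (x, s) with s outside [p], modulo
   (x, s) ~ (y, t) iff u t x = u s y for some u outside [p], as an R-module. *)
Section Localization.
Variables (R : comNzRingType) (p : set R) (pP : prime_ideal p).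

Record denom : Type := Denom { dval : R; denom_valP : dval \notin p }.
HB.instance Definition _ := [isSub for dval].
HB.instance Definition _ := [Choice of denom by <:].

Lemma denomP (s : denom) : ~ p (dval s).
Proof. by move=> ps; case/negP: (denom_valP s); exact/mem_set. Qed.

Lemma denom1_subproof : 1 \notin p.
Proof. by case/prime_idealP: pP => _ p1 _; apply/negP => /set_mem. Qed.

Lemma denomM_subproof (s t : denom) : dval s * dval t \notin p.
Proof.
case/prime_idealP: pP => _ _ pM; apply/negP => /set_mem /pM[]; exact: denomP.
Qed.

Definition denom1 : denom := Denom denom1_subproof.
Definition denomM (s t : denom) : denom :=
  Denom (denomM_subproof s t).

Variable M : lmodType R.

Definition loc_equiv (x y : M * denom) : bool :=
  `[< exists u : denom,
        dval u *: (dval y.2 *: x.1) = dval u *: (dval x.2 *: y.1) >].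

Lemma loc_equiv_refl : reflexive loc_equiv.
Proof. by move=> x; apply/asboolP; exists denom1. Qed.

Lemma loc_equiv_sym : symmetric loc_equiv.
Proof. by move=> x y; apply/asboolP/asboolP => -[u h]; exists u. Qed.

Lemma loc_equiv_trans : transitive loc_equiv.
Proof.
move=> [y t] [x s] [z r] /asboolP[u /= hu] /asboolP[v /= hv].
apply/asboolP; exists (denomM t (denomM u v)) => /=.
move: hu hv; rewrite !scalerA => hu hv.
transitivity ((dval v * dval r) *: ((dval u * dval t) *: x)).
  by rewrite scalerA; congr (_ *: x); ring.
rewrite hu; transitivity ((dval u * dval s) *: ((dval v * dval r) *: y)).
  by rewrite !scalerA; congr (_ *: y); ring.
by rewrite hv !scalerA; congr (_ *: z); ring.
Qed.

Canonical loc_equiv_equiv :=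
  EquivRel loc_equiv loc_equiv_refl loc_equiv_sym loc_equiv_trans.

Definition loc : Type := {eq_quot loc_equiv}.

HB.instance Definition _ := EqQuotient.on loc.
HB.instance Definition _ := Choice.on loc.

Definition frac (x : M) (s : denom) : loc := \pi_loc (x, s).

Lemma frac_eq (x y : M) (s t : denom) :
  frac x s = frac y t <->
  exists u : denom, dval u *: (dval t *: x) = dval u *: (dval s *: y).
Proof.
split=> [/eqmodP/asboolP //|h].
by apply/eqmodP/asboolP.
Qed.

Lemma frac_surj (z : loc) : exists x s, z = frac x s.
Proof. by elim/quotW: z => -[x s]; exists x, s. Qed.

Definition numer (z : loc) : M := (repr z).1.
Definition den (z : loc) : denom := (repr z).2.

Lemma fracK (z : loc) : frac (numer z) (den z) = z.
Proof. by rewrite /frac -surjective_pairing reprK. Qed.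

Definition loc_add (z w : loc) : loc :=
  frac (dval (den w) *: numer z + dval (den z) *: numer w) (denomM (den z) (den w)).
Definition loc_opp (z : loc) : loc := frac (- numer z) (den z).
Definition loc_scale (a : R) (z : loc) : loc := frac (a *: numer z) (den z).

Lemma loc_addE (x y : M) (s t : denom) :
  loc_add (frac x s) (frac y t) = frac (dval t *: x + dval s *: y) (denomM s t).
Proof.
rewrite /loc_add.
have /frac_eq[u] := fracK (frac x s); have /frac_eq[v] := fracK (frac y t).
move: (numer (frac x s)) (den (frac x s)) => x' s'.
move: (numer (frac y t)) (den (frac y t)) => y' t'.
rewrite !scalerA => hv hu; apply/frac_eq; exists (denomM u v) => /=.
rewrite !scalerDr !scalerA; congr (_ + _).
  transitivity ((dval v * dval t * dval t') *: ((dval u * dval s) *: x')).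
    by rewrite scalerA; congr (_ *: _); ring.
  by rewrite hu scalerA; congr (_ *: _); ring.
transitivity ((dval u * dval s * dval s') *: ((dval v * dval t) *: y')).
  by rewrite scalerA; congr (_ *: _); ring.
by rewrite hv scalerA; congr (_ *: _); ring.
Qed.

Lemma loc_oppE (x : M) (s : denom) : loc_opp (frac x s) = frac (- x) s.
Proof.
have /frac_eq[u hu] := fracK (frac x s).
by apply/frac_eq; exists u; rewrite !scalerN hu.
Qed.

Lemma loc_scaleE (a : R) (x : M) (s : denom) :
  loc_scale a (frac x s) = frac (a *: x) s.
Proof.
have /frac_eq[u hu] := fracK (frac x s).
apply/frac_eq; exists u; rewrite !scalerA in hu *.
by rewrite ![_ * _ * a]mulrC -!(scalerA a) hu.
Qed.

Lemma loc_addA : associative loc_add.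
Proof.
move=> z w v.
have [x [s ->]] := frac_surj z; have [y [t ->]] := frac_surj w.
have [m [r ->]] := frac_surj v; rewrite !loc_addE; apply/frac_eq.
exists denom1; rewrite /= !scale1r !scalerDr !scalerA addrA.
by congr (_ *: _ + _ *: _ + _ *: _); ring.
Qed.

Lemma loc_addC : commutative loc_add.
Proof.
move=> z w; have [x [s ->]] := frac_surj z; have [y [t ->]] := frac_surj w.
rewrite !loc_addE; apply/frac_eq; exists denom1.
by rewrite /= addrC [dval t * _]mulrC.
Qed.

Lemma loc_add0 : left_id (frac 0 denom1) loc_add.
Proof.
move=> z; have [x [s ->]] := frac_surj z; rewrite loc_addE.
by apply/frac_eq; exists denom1; rewrite /= scaler0 add0r !scale1r mul1r.
Qed.

Lemma loc_addN : left_inverse (frac 0 denom1) loc_opp loc_add.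
Proof.
move=> z; have [x [s ->]] := frac_surj z; rewrite loc_oppE loc_addE.
by apply/frac_eq; exists denom1; rewrite /= scalerN addNr !scaler0.
Qed.

HB.instance Definition _ :=
  GRing.isZmodule.Build loc loc_addA loc_addC loc_add0 loc_addN.

Lemma loc_scaleA (a b : R) (z : loc) :
  loc_scale a (loc_scale b z) = loc_scale (a * b) z.
Proof. by have [x [s ->]] := frac_surj z; rewrite !loc_scaleE scalerA. Qed.

Lemma loc_scale1 : left_id 1 loc_scale.
Proof. by move=> z; have [x [s ->]] := frac_surj z; rewrite loc_scaleE scale1r. Qed.

Lemma loc_scaleDr : right_distributive loc_scale +%R.
Proof.
move=> a z w; have [x [s ->]] := frac_surj z; have [y [t ->]] := frac_surj w.
rewrite -![_ + _]/(loc_add _ _) !(loc_scaleE, loc_addE).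
by rewrite scalerDr !scalerA ![a * _]mulrC.
Qed.

Lemma loc_scaleDl (z : loc) : {morph loc_scale^~ z : a b / a + b}.
Proof.
move=> a b; have [x [s ->]] := frac_surj z.
rewrite -[_ + loc_scale _ _]/(loc_add _ _) !loc_scaleE loc_addE.
apply/frac_eq; exists denom1; rewrite /= !scale1r -scalerDr -scalerDl.
by rewrite -scalerA.
Qed.

HB.instance Definition _ := GRing.Zmodule_isLmodule.Build R loc
  loc_scaleA loc_scale1 loc_scaleDr loc_scaleDl.

Definition localize (N : set M) : set loc :=
  [set z | exists x (s : denom), N x /\ z = frac x s].

Lemma localize_submodule (N : set M) : submodule N -> submodule (localize N).
Proof.
move=> /submoduleP[N0 NS]; apply/submoduleP; split; first by exists 0, denom1.
have NZ a x : N x -> N (a *: x) by move=> Nx; rewrite -[_ *: _]addr0; exact: NS.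
move=> a _ _ [x [s [Nx ->]]] [y [t [Ny ->]]].
exists (dval t *: (a *: x) + dval s *: y), (denomM s t); split.
  by apply: NS; exact: NZ.
by rewrite -[_ + _ in LHS]/(loc_add (loc_scale _ _) _) loc_scaleE loc_addE.
Qed.

End Localization.

Arguments loc {R p} pP M.
Arguments frac {R p} pP {M} x s.
Arguments localize {R p} pP {M} N.

(* Main.v *)
Require Import Defs.
From mathcomp Require Import all_boot all_order all_algebra.
From mathcomp Require Import boolp classical_sets.

Set Implicit Arguments.
Unset Strict Implicit.
Unset Printing Implicit Defensive.

(** For the forward implication, the chain of submodules [N : r^k] stabilizes,
so [(N : r^k) `&` r^k M `<=` N] for large [k] and [N] is primary. Choose [x]
outside [N] with [p := N : x] maximal; this [p] is prime, equals the radical of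
[N : M], and [L := (N : p) `&` p M] works. Indeed, if [y] in [N : p] is outside
[N] and [K] is not inside [N], then [R y `&` K] is not inside [N], which yields
[a y] in [K] with [a] outside [p]. Taking [K := p M], which is not inside [N]
since [N : M] is not [p], shows moreover that [L] strictly contains [N].
For the converse, if neither [K] nor [K'] lies in [N], then every element of
[L] has a multiple by some [s] outside [p] in [K `&` K']. *)

Import GRing.Theory.
Local Open Scope ring_scope.
Local Open Scope classical_set_scope.

(** * Closure properties of submodules *)

Section Submodules.
Variables (R : comNzRingType) (M : lmodType R).
Implicit Types N K : set M.

Lemma submodule0 N : submodule N -> N 0.
Proof. by case/submoduleP. Qed.

Lemma submoduleZ N a x : submodule N -> N x -> N (a *: x).
Proof. by move=> /submoduleP[N0 NS] Nx; rewrite -[_ *: _]addr0; exact: NS. Qed.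

Lemma submoduleD N x y : submodule N -> N x -> N y -> N (x + y).
Proof. by move=> /submoduleP[_ NS] Nx Ny; rewrite -[x]scale1r; exact: NS. Qed.

Lemma submoduleB N x y : submodule N -> N x -> N y -> N (x - y).
Proof.
move=> sN Nx Ny; apply: submoduleD => //.
by rewrite -scaleN1r; exact: submoduleZ.
Qed.

Lemma submodule_sum N n (f : 'I_n -> M) :
  submodule N -> (forall i, N (f i)) -> N (\sum_(i < n) f i).
Proof.
by move=> sN Nf; apply: big_ind => // [|x y]; [exact: submodule0|exact: submoduleD].
Qed.

Lemma submoduleI N K : submodule N -> submodule K -> submodule (N `&` K).
Proof.
move=> /submoduleP[N0 NS] /submoduleP[K0 KS]; apply/submoduleP; split=> //.
by move=> a x y [Nx Kx] [Ny Ky]; split; [exact: NS|exact: KS].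
Qed.

Lemma submodule_preim N (f : {linear M -> M}) :
  submodule N -> submodule (f @^-1` N).
Proof.
move=> sN; apply/submoduleP; split=> [|a x y Nx Ny] /=.
  by rewrite linear0; exact: submodule0.
by rewrite linearP; apply: submoduleD => //; exact: submoduleZ.
Qed.

Lemma submodule_range (f : {linear M -> M}) : submodule (range f).
Proof.
apply/submoduleP; split=> [|a _ _ [x _ <-] [y _ <-]].
  by exists 0; rewrite ?linear0.
by exists (a *: x + y); rewrite ?linearP.
Qed.

Lemma submodule_cyclic (x : M) : submodule (range (fun a : R => a *: x)).
Proof.
apply/submoduleP; split; first by exists 0; rewrite ?scale0r.
by move=> a _ _ [b _ <-] [c _ <-]; exists (a * b + c); rewrite // scalerDl scalerA.
Qed.

End Submodules.

(** * Products [bM], colon ideals, and containment after localization *)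

Section IdealsAndLocalization.
Variables (R : comNzRingType) (M : lmodType R).
Implicit Types N K L : set M.

Lemma submodule_ideal_mul (b : set R) : ideal b -> submodule (ideal_mul M b).
Proof.
move=> sb; apply/submoduleP; split.
  by exists 0%N, (fun=> 0), (fun=> 0); split=> [[]//|]; rewrite big_ord0.
move=> r _ _ [m [a [y [ba ->]]]] [n [c [z [bc ->]]]].
exists (m + n)%N,
  (fun i => match split i with inl i => r * a i | inr i => c i end),
  (fun i => match split i with inl i => y i | inr i => z i end).
split=> [i|].
  by case: split => j; [exact: (submoduleZ (M := R^o))|exact: bc].
rewrite big_split_ord /= scaler_sumr; congr (_ + _); apply: eq_bigr => i _.
  by rewrite scalerA -[lshift n i]/(unsplit (inl i)) unsplitK.
by rewrite -[rshift m i]/(unsplit (inr i)) unsplitK.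
Qed.

Lemma ideal_mulS (b c : set R) : b `<=` c -> ideal_mul M b `<=` ideal_mul M c.
Proof. by move=> bc x [n [a [y [ba ->]]]]; exists n, a, y; split=> // i; exact: bc. Qed.

Lemma ideal_mulM (b : set R) r (x : M) : b r -> ideal_mul M b (r *: x).
Proof. by move=> br; exists 1%N, (fun=> r), (fun=> x); rewrite big_ord1. Qed.

Lemma ideal_mul_sub (b : set R) N :
  submodule N -> (forall r x, b r -> N (r *: x)) -> ideal_mul M b `<=` N.
Proof.
move=> sN bN _ [n [a [y [ba ->]]]].
by apply: submodule_sum => // i; exact: bN.
Qed.

Lemma ideal_colon N : submodule N -> ideal (colon N).
Proof.
move=> sN; apply/submoduleP; split=> [x|a r s Nr Ns x].
  by rewrite scale0r; exact: submodule0.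
rewrite scalerDl -scalerA; apply: submoduleD => //.
exact: submoduleZ.
Qed.

Lemma ideal_annihilator N (x : M) :
  submodule N -> ideal [set r : R | N (r *: x)].
Proof.
move=> sN; apply/submoduleP; split=> [|a r s Nr Ns] /=.
  by rewrite scale0r; exact: submodule0.
rewrite scalerDl -scalerA; apply: submoduleD => //.
exact: submoduleZ.
Qed.

(** If [N] is [bM], then [b] lies in [colon N], which squeezes [N] between [bM] and itself.
    Submodules are thus determined by their colon ideals, and chain conditions on ideals pass to
    [M]. *)
Lemma multiplication_colonK N :
  multiplication_module M -> submodule N -> ideal_mul M (colon N) = N.
Proof.
move=> mulM sN; apply/seteqP; split; first by apply: ideal_mul_sub => // r x.
have [b _ NE] := mulM N sN; rewrite [X in X `<=` _]NE; apply: ideal_mulS => r br x.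
by rewrite NE; exact: ideal_mulM.
Qed.

Lemma localize_frac (p : set R) (pP : prime_ideal p) K x s : submodule K ->
  localize pP K (Defs.frac pP x s) <-> exists2 t, ~ p t & K (t *: x).
Proof.
move=> sK; split=> [[y [t [Ky /frac_eq[u e]]]]|[t pt Kt]].
  exists (dval u * dval t); first exact: (@denomP _ _ (denomM pP u t)).
  by rewrite -scalerA e; do 2 apply: submoduleZ => //.
have tp : t \notin p by apply/negP => /set_mem.
exists (t *: x), (denomM pP (Denom tp) s); split=> //.
apply/frac_eq; exists (denom1 pP) => /=.
by rewrite !scale1r scalerA mulrC.
Qed.

(** Clears denominators, so that the theorem can argue with elements of [M] only. *)
Lemma localizeS (p : set R) (pP : prime_ideal p) L K : submodule K ->
  localize pP L `<=` localize pP K <->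
  forall x, L x -> exists2 t, ~ p t & K (t *: x).
Proof.
move=> sK; split=> [LK x Lx|LK _ [x [s [Lx ->]]]].
  by apply/(localize_frac pP x (denom1 pP) sK)/LK; exists x, (denom1 pP).
exact/localize_frac/LK.
Qed.

End IdealsAndLocalization.

(** * Chain conditions, primary submodules and associated primes *)

Section Noetherian.
Variable R : comNzRingType.
Hypothesis R_noetherian : noetherian R.

(** The union of the chain is a finitely generated ideal, and the largest of the indices at which
    its generators appear serves as [k]. *)
Lemma noetherian_chain (I : nat -> set R) :
  (forall k, ideal (I k)) -> {homo I : m n / (m <= n)%N >-> m `<=` n} ->
  exists k, forall n, I n `<=` I k.
Proof.
move=> iI mI; pose U := \bigcup_k I k.
have iU : ideal U.
  apply/submoduleP; split; first by exists 0%N => //; exact: submodule0 (iI 0%N).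
  move=> a x y [m _ Ix] [n _ Iy]; exists (maxn m n) => //.
  have /submoduleP[_] := iI (maxn m n).
  by apply; [apply: mI Ix; exact: leq_maxl|apply: mI Iy; exact: leq_maxr].
have [n [g UE]] := R_noetherian iU.
have /choice[k Ig] i : exists k, I k (g i).
  suff [j _ Ij] : U (g i) by exists j.
  rewrite UE; exists (fun j => (j == i)%:R).
  rewrite (bigD1 i) //= eqxx mul1r big1 ?addr0 // => j /negPf ->.
  by rewrite mul0r.
exists (\max_i k i) => m x Ix.
have : U x by exists m.
rewrite UE => -[c ->].
apply: (submodule_sum (M := R^o) (iI _)) => i.
apply: (submoduleZ (M := R^o) _ (iI _)).
by apply: mI (Ig i); exact: leq_bigmax.
Qed.

(** Without a maximal member, choice gives a strict enlargement [f] on [P], whose iterates form a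
    chain that never stabilizes. *)
Lemma noetherian_maximal (P : set (set R)) :
  P !=set0 -> P `<=` @ideal R ->
  exists2 I, P I & forall J, P J -> I `<=` J -> J `<=` I.
Proof.
move=> [I0 PI0] Pi; apply: contrapT => nomax.
have /choice[f fP] (I : {I | P I}) :
    exists J : {I | P I}, sval I `<=` sval J /\ ~ (sval J `<=` sval I).
  case: I => I PI; apply: contrapT => nJ; apply: nomax; exists I => // J PJ IJ.
  by apply: contrapT => nJI; apply: nJ; exists (exist _ J PJ).
pose I k := iter k f (exist _ I0 PI0).
have [k kmax] : exists k, forall n, sval (I n) `<=` sval (I k).
  apply: noetherian_chain => [k|]; first exact/Pi/svalP.
  apply: homo_leq => [J|J K L|k] //; first exact: subset_trans.
  exact: (fP (I k)).1.
exact: (fP (I k)).2 (kmax k.+1).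
Qed.

Variable M : lmodType R.
Hypothesis M_multiplication : multiplication_module M.
Variable N : set M.
Hypothesis N_proper : proper_submodule N.

Lemma strongly_irreducible_primary : strongly_irreducible N -> primary N.
Proof.
move=> [sN irrN]; split=> // r x Nrx Nx.
pose Nr k := [set y | N (r ^+ k *: y)].
have sNr k : submodule (Nr k) := submodule_preim ( *:%R (r ^+ k)) sN.
have NrS m n : (m <= n)%N -> Nr m `<=` Nr n.
  move=> /subnK <- y Ny; rewrite /Nr /= exprD -scalerA.
  exact: submoduleZ.
(* The chain condition concerns ideals, so it is applied to the colons; [multiplication_colonK] then
   brings it back to the submodules [Nr n]. *)
have [k kmax] : exists k, forall n, colon (Nr n) `<=` colon (Nr k).
  apply: noetherian_chain => [k|m n mn s Ns y]; first exact: ideal_colon.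
  exact/NrS/Ns.
have NrK n : Nr n `<=` Nr k.
  rewrite -(multiplication_colonK M_multiplication (sNr n)).
  rewrite -(multiplication_colonK M_multiplication (sNr k)).
  exact/ideal_mulS.
have [||NrN|rkN] := irrN (Nr k) (range ( *:%R (r ^+ k))) (sNr k).
- exact: submodule_range.
(* With [z = r ^+ k *: y], the hypothesis on [z] puts [y] in [Nr (k + k)], hence in [Nr k], which
   says that [z] is in [N]. *)
- move=> z [Nrz [y _ yz]]; rewrite -yz; apply: (NrK (k + k)%N).
  by rewrite /Nr /= exprD -scalerA yz.
- by case: Nx; apply: NrN; apply: (NrK 1%N); rewrite /Nr /= expr1.
(* The exponent [k.+1] is positive even when [k] is zero, as [radical] demands. *)
- exists k.+1 => // y; rewrite exprSr -scalerA; apply: rkN; exact: imageT.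
Qed.

Lemma primary_associated_prime : primary N ->
  exists x, [/\ ~ N x, prime_ideal [set r | N (r *: x)] &
    [set r | N (r *: x)] = radical (colon N)].
Proof.
move=> [[sN nT] primN].
have [y Ny] : exists y, ~ N y.
  apply: contrapT => nN; apply: nT; apply/seteqP; split=> // y _.
  by apply: contrapT => Ny; apply: nN; exists y.
pose ann x := [set r | N (r *: x)].
have [||_ [x Nx <-] xmax] := @noetherian_maximal [set ann x | x in ~` N].
- by exists (ann y), y.
- by move=> _ [x _ <-]; exact: ideal_annihilator.
have annP : prime_ideal (ann x).
  apply/prime_idealP; split=> [||a b abx]; first exact: ideal_annihilator.
    by rewrite /ann /= scale1r.
  have [|Nbx] := pselect (N (b *: x)); first by right.
  (* As [b *: x] is outside [N], its annihilator modulo [N] competes with [ann x]; it contains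
     [ann x] and also [a]. *)
  left; apply: (xmax (ann (b *: x))); first by exists (b *: x).
    move=> r Nr; rewrite /ann /= scalerA mulrC -scalerA.
    exact: submoduleZ.
  by rewrite /ann /= scalerA.
exists x; split=> //; apply/seteqP; split=> r; first by move/primN; apply.
move=> [n _ rN]; have {rN} : ann x (r ^+ n) := rN x.
have /prime_idealP[_ ann1 annM] := annP.
by elim: n => [|n IHn]; rewrite ?expr0 // exprS => /annM[].
Qed.

End Noetherian.

(** * The equivalence for submodules with non-prime colon ideal *)

Theorem proposition1p6 (R : comNzRingType) (M : lmodType R) (N : set M)
    (R_noetherian : noetherian R)
    (M_multiplication : multiplication_module M)
    (N_proper : proper_submodule N)
    (colon_not_prime : ~ prime_ideal (colon N)) :
  strongly_irreducible N <->
  exists (L : set M) (p : set R) (pP : prime_ideal p),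
    [/\ submodule L,
        primary_to p N,
        N `<` L /\ L `<=` ideal_mul M p &
        forall K : set M, submodule K ->
          K `<=` N \/ localize pP L `<=` localize pP K].
Proof.
have [sN _] := N_proper; split=> [siN|[L [p [pP [sL [[_ primN] pE] [[NL LN] _] Lloc]]]]].
  have primN : primary N.
    exact: strongly_irreducible_primary.
  have [x [Nx pP pE]] := primary_associated_prime R_noetherian primN.
  set p := [set r | N (r *: x)] in pP pE.
  have colon_p : colon N `<=` p by move=> r; apply.
  have ip : ideal p by exact: ideal_annihilator.
  have spM : submodule (ideal_mul M p) by exact: submodule_ideal_mul.
  (* [S] is the submodule written [N : p] above; it contains [x], because [p] annihilates [x] modulo
     [N]. *)
  pose S := [set y | forall r, p r -> N (r *: y)].
  have sS : submodule S.
    apply/submoduleP; split=> [r _|a y z Sy Sz r pr].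
      by rewrite scaler0; exact: submodule0.
    rewrite scalerDr scalerA mulrC -scalerA.
    by apply: submoduleD; [|apply: submoduleZ; [|exact: Sy]|exact: Sz].
  have NS : N `<=` S by move=> y Ny r _; exact: submoduleZ.
  have SNloc K y : submodule K -> ~ K `<=` N -> S y -> ~ N y ->
      exists2 t, ~ p t & K (t *: y).
    move=> sK KN Sy Ny; apply: contrapT => nt.
    (* If no such [t] existed, every [a] with [a *: y] in [K] would lie in [p], so that [R y] and
       [K] would meet inside [N]. *)
    have [|yN|//] := siN.2 (range (fun a => a *: y)) K (submodule_cyclic y) sK.
      move=> _ [[a _ <-] Kay]; apply: Sy; apply: contrapT => pa.
      by apply: nt; exists a.
    by apply/Ny/yN; exists 1; rewrite ?scale1r.
  have Sloc K y : submodule K -> ~ K `<=` N -> S y -> exists2 t, ~ p t & K (t *: y).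
    (* For [y] in [N], both [x] and [x + y] lie in [S] outside [N]; their multipliers [t] and [u]
       combine to [t * u] for the difference [y]. *)
    move=> sK KN Sy; have [Ny|] := pselect (N y); last exact: SNloc.
    have Sx : S x by move=> r.
    have [t pt Kx] := SNloc K x sK KN Sx Nx.
    have [||u pu Ku] := SNloc K (x + y) sK KN.
    - exact: submoduleD sS Sx Sy.
    - by move=> Nxy; apply: Nx; rewrite -[x](addrK y); exact: submoduleB.
    exists (t * u); first by case/prime_idealP: pP => _ _ pM /pM[].
    rewrite -[y](addKr x) scalerDr scalerN addrC; apply: submoduleB => //.
      by rewrite -scalerA; exact: submoduleZ.
    by rewrite mulrC -scalerA; exact: submoduleZ.
  have pMN : ~ ideal_mul M p `<=` N.
    move=> pMN; apply: colon_not_prime; suff -> : colon N = p by [].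
    by apply/seteqP; split=> // r pr y; apply: pMN; exact: ideal_mulM.
  exists (S `&` ideal_mul M p), p, pP; split.
  - exact: submoduleI.
  - by [].
  - split; last by move=> y [].
    split.
      move=> y Ny; split; first exact: NS.
      rewrite -(multiplication_colonK M_multiplication sN) in Ny.
      exact: ideal_mulS Ny.
    (* A multiple [t *: x] with [t] outside [p] lies in [L], but not in [N] since [p] consists of
       all [r] with [r *: x] in [N]. *)
    move=> LN; have Sx : S x by move=> r.
    have [t pt pMx] := Sloc _ x spM pMN Sx.
    by apply/pt/LN; split=> //; exact: (submoduleZ t sS Sx).
  - move=> K sK; have [|KN] := pselect (K `<=` N); first by left.
    by right; apply/localizeS => // y [Sy _]; exact: Sloc.
split=> // K K' sK sK' KK'.
have [|/(localizeS _ _ sK) LK] := Lloc K sK; first by left.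
have [|/(localizeS _ _ sK') LK'] := Lloc K' sK'; first by right.
case: LN => x Lx; apply: contrapT => Nx.
have [s ps Ks] := LK x Lx; have [t pt Kt] := LK' x Lx.
have /prime_idealP[_ _ pM] := pP.
(* The element [(s * t) *: x] lies in both [K] and [K'], hence in [N]; as [x] does not, primariness
   forces [s * t] into [p]. *)
suff : p (s * t) by case/pM.
rewrite pE; apply: primN Nx; apply: KK'; split.
  by rewrite mulrC -scalerA; exact: submoduleZ.
by rewrite -scalerA; exact: submoduleZ.
Qed.
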